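(* The modal logic $\mathbf{Grz.2}$ has the uniform Lyndon interpolation property.
   Context: Modal formulas use variables, $\bot,\land,\lor,\neg,\to,\Box$, with $\Diamond\varphi:=\neg\Box\neg\varphi$. Polarity: $v^+(p)=\{p\}$, $v^-(p)=\emptyset$, $v^\circ(\bot)=\emptyset$, $\land,\lor,\Box$ preserve polarity, $v^\pm(\neg\varphi)=v^\mp(\varphi)$, $v^+(\varphi\to\psi)=v^-(\varphi)\cup v^+(\psi)$, $v^-(\varphi\to\psi)=v^+(\varphi)\cup v^-(\psi)$. $\mathbf{Grz}$ is the Grzegorczyk logic ($\mathbf{K}+\Box(\Box(p\to\Box p)\to p)\to p$). $\mathbf{Grz.2}$ is the least normal modal logic extending $\mathbf{Grz}$ and containing $\alpha(p):=\Box(\Box\Diamond p\leftrightarrow\Diamond\Box p)$. A logic $L$ has the uniform Lyndon interpolation property iff for every formula $\varphi$ and finite sets $P^+,P^-$ of variables there is $\theta$ with $L\vdash\varphi\to\theta$, $v^\circ(\theta)\subseteq v^\circ(\varphi)\setminus P^\circ$ for $\circ\in\{+,-\}$, and $L\vdash\theta\to\psi$ for every $\psi$ with $L\vdash\varphi\to\psi$ and $v^\circ(\psi)\cap P^\circ=\emptyset$ for $\circ\in\{+,-\}$. *)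

(* Defs.v *)
From mathcomp Require Import all_boot.
From mathcomp Require Import finmap.
Set Implicit Arguments.
Unset Strict Implicit.
Unset Printing Implicit Defensive.
Local Open Scope fset_scope.

Inductive form : Type :=
| Var of nat
| Bot
| And of form & form
| Or of form & form
| Neg of form
| Imp of form & form
| Box of form.

Definition Dia (A : form) : form := Neg (Box (Neg A)).
Definition Iff (A B : form) : form := And (Imp A B) (Imp B A).

Fixpoint subst (s : nat -> form) (A : form) : form :=
  match A with
  | Var p => s p
  | Bot => Bot
  | And B C => And (subst s B) (subst s C)
  | Or B C => Or (subst s B) (subst s C)
  | Neg B => Neg (subst s B)
  | Imp B C => Imp (subst s B) (subst s C)
  | Box B => Box (subst s B)
  end.

Inductive polarity : Type := Plus | Minus.

Definition flip (o : polarity) : polarity :=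
  match o with Plus => Minus | Minus => Plus end.

Fixpoint vars (o : polarity) (A : form) : {fset nat} :=
  match A with
  | Var p => match o with Plus => [fset p] | Minus => fset0 end
  | Bot => fset0
  | And B C => vars o B `|` vars o C
  | Or B C => vars o B `|` vars o C
  | Neg B => vars (flip o) B
  | Imp B C => vars (flip o) B `|` vars o C
  | Box B => vars o B
  end.

(* Only the values of [e] at variables and at boxed formulas matter: both are
   treated as propositional atoms. *)
Fixpoint prop_eval (e : form -> bool) (A : form) : bool :=
  match A with
  | Var _ => e A
  | Bot => false
  | And B C => prop_eval e B && prop_eval e C
  | Or B C => prop_eval e B || prop_eval e C
  | Neg B => ~~ prop_eval e B
  | Imp B C => prop_eval e B ==> prop_eval e C
  | Box _ => e A
  end.

Definition tautology (A : form) : Prop := forall e, prop_eval e A.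

(* A logic is identified with its set of theorems: [L A] reads L |- A. *)
Definition logic : Type := form -> Prop.

Definition axK : form :=
  Imp (Box (Imp (Var 0) (Var 1))) (Imp (Box (Var 0)) (Box (Var 1))).

Record normal (L : logic) : Prop := Normal {
  normal_taut : forall A, tautology A -> L A;
  normal_K : L axK;
  normal_mp : forall A B, L (Imp A B) -> L A -> L B;
  normal_nec : forall A, L A -> L (Box A);
  normal_subst : forall (s : nat -> form) A, L A -> L (subst s A)
}.

Definition normal_ext (L0 : logic) (X : form) : logic := fun A =>
  forall L : logic, normal L -> (forall B, L0 B -> L B) -> L X -> L A.

Definition logicK : logic := fun A => forall L : logic, normal L -> L A.

Definition axGrz (p : form) : form :=
  Imp (Box (Imp (Box (Imp p (Box p))) p)) p.

Definition ax2 (p : form) : form :=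
  Box (Iff (Box (Dia p)) (Dia (Box p))).

Definition Grz : logic := normal_ext logicK (axGrz (Var 0)).

Definition Grz2 : logic := normal_ext Grz (ax2 (Var 0)).

Definition uniform_Lyndon_interpolation (L : logic) : Prop :=
  forall (phi : form) (P : polarity -> {fset nat}),
  exists theta : form,
    [/\ L (Imp phi theta),
        forall o, vars o theta `<=` vars o phi `\` P o
      & forall psi : form,
          L (Imp phi psi) ->
          (forall o, vars o psi `&` P o = fset0) ->
          L (Imp theta psi)].

(* Main.v *)
(** Grz.2 is the logic of posets of finite rank with a greatest element.  For
[theta] take the conjunction of all consequences of [phi] that are disjunctions
of formulas from a finite stock [layer Q n] of formulas over the allowed signed
variables.  If [M], [m] forces [theta], then some [K], [k] forcing [phi] is
related to [M], [m] by an [n]-layered directed bisimulation.  For [n] large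
enough this can be amalgamated: pairs [(k', m')] related up to a layer depending
on the number [rho] of relevant boxes failing at [k'] form a model projecting
p-morphically onto [M], while keeping the truth of [phi] from [K].  Because the
relevant boxes include [Box (A -> Box A)], a failing [Box A] is refuted either
at the point itself or at a point of smaller [rho], so pairs can be ordered
strictly by [rho] and the order of [M], which makes the amalgam a poset;
counting one more unit of [rho] below the top of [K] gives it a greatest
element. *)

From HB Require Import structures.
From mathcomp Require Import all_boot finmap.
From mathcomp Require Import boolp zify.
Require Import Defs.
Set Implicit Arguments.
Unset Strict Implicit.
Unset Printing Implicit Defensive.

(** * Countability of formulas *)

Fixpoint tree_of_form (A : form) : GenTree.tree nat :=
  match A with
  | Var p => GenTree.Leaf p
  | Bot => GenTree.Node 0 [::]
  | And B C => GenTree.Node 1 [:: tree_of_form B; tree_of_form C]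
  | Or B C => GenTree.Node 2 [:: tree_of_form B; tree_of_form C]
  | Neg B => GenTree.Node 3 [:: tree_of_form B]
  | Imp B C => GenTree.Node 4 [:: tree_of_form B; tree_of_form C]
  | Box B => GenTree.Node 5 [:: tree_of_form B]
  end.

Fixpoint form_of_tree (t : GenTree.tree nat) : option form :=
  match t with
  | GenTree.Leaf p => Some (Var p)
  | GenTree.Node 1 [:: t1; t2] =>
      obind (fun B => omap (And B) (form_of_tree t2)) (form_of_tree t1)
  | GenTree.Node 2 [:: t1; t2] =>
      obind (fun B => omap (Or B) (form_of_tree t2)) (form_of_tree t1)
  | GenTree.Node 3 [:: t1] => omap Neg (form_of_tree t1)
  | GenTree.Node 4 [:: t1; t2] =>
      obind (fun B => omap (Imp B) (form_of_tree t2)) (form_of_tree t1)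
  | GenTree.Node 5 [:: t1] => omap Box (form_of_tree t1)
  | _ => Some Bot
  end.

Lemma tree_of_formK : pcancel tree_of_form form_of_tree.
Proof. by elim=> //= [A -> B ->|A -> B ->|A ->|A -> B ->|A ->]. Qed.

HB.instance Definition _ := Countable.copy form (pcan_type tree_of_formK).

(** * Finite conjunctions, disjunctions and subsequences *)

Definition Conj (s : seq form) : form := foldr And (Neg Bot) s.
Definition Disj (s : seq form) : form := foldr Or Bot s.

(** A finite stand-in for the powerset: by [filter_subseqs] it contains every part of [s] cut out by
    a predicate. *)
Definition subseqs (T : eqType) (s : seq T) : seq (seq T) :=
  [seq mask (tval m) s | m : (size s).-tuple bool].

Lemma filter_subseqs (T : eqType) (a : pred T) (s : seq T) :
  filter a s \in subseqs s.
Proof.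
apply/imageP; exists (map_tuple a (in_tuple s)) => //=.
by rewrite filter_mask.
Qed.

Lemma mem_subseqs (T : eqType) (s r : seq T) :
  r \in subseqs s -> {subset r <= s}.
Proof. by case/imageP=> m _ -> x; apply: mem_mask. Qed.

Lemma vars_foldr (op : form -> form -> form) (A0 : form) (s : seq form)
    (o : polarity) (V : {fset nat}) :
  (forall B C, vars o (op B C) = (vars o B `|` vars o C)%fset) ->
  vars o A0 = fset0 -> {in s, forall A, vars o A `<=` V}%fset ->
  (vars o (foldr op A0 s) `<=` V)%fset.
Proof.
move=> opE A00; elim: s => [|A s IHs] sV /=; first by rewrite A00 fsub0set.
rewrite opE fsubUset sV ?mem_head //= IHs // => B sB.
by apply: sV; rewrite in_cons sB orbT.
Qed.

Lemma leq_count_in (T : eqType) (a b : pred T) (s : seq T) :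
  {in s, forall x, a x -> b x} -> count a s <= count b s.
Proof.
elim: s => //= x s IHs sab; apply: leq_add; last first.
  by apply: IHs => y sy; apply: sab; rewrite in_cons sy orbT.
by have := sab x (mem_head _ _); case: (a x) => // ->.
Qed.

Lemma ltn_count_in (T : eqType) (a b : pred T) (s : seq T) (x : T) :
  {in s, forall y, a y -> b y} -> x \in s -> b x -> ~~ a x ->
  count a s < count b s.
Proof.
move=> sab sx bx nax; have /permP perm_s := perm_to_rem sx.
rewrite !perm_s /= bx (negPf nax) add0n ltnS; apply: leq_count_in => y sy.
by apply: sab; apply: mem_rem sy.
Qed.

(** * Models *)

(** [lt_rank] makes [lt] irreflexive and bounds the chains above each world while allowing
    infinitely many worlds. *)
Record model := Model {
  world :> Type;
  lt : world -> world -> Prop;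
  rank : world -> nat;
  top : world;
  val : nat -> world -> Prop;
  lt_trans : forall x y z, lt x y -> lt y z -> lt x z;
  lt_rank : forall x y, lt x y -> rank y < rank x;
  lt_top : forall x, x = top \/ lt x top
}.
Arguments top {m}.

Definition le (M : model) (x y : M) : Prop := x = y \/ lt x y.

Lemma le_refl (M : model) (x : M) : le x x.
Proof. by left. Qed.
#[local] Hint Resolve le_refl : core.

Lemma le_trans (M : model) (x y z : M) : le x y -> le y z -> le x z.
Proof.
case=> [->|xy] // [<-|yz]; right=> //; exact: lt_trans yz.
Qed.

Lemma le_top (M : model) (x : M) : le x top.
Proof. exact: lt_top. Qed.
#[local] Hint Resolve le_top : core.

Lemma le_rank (M : model) (x y : M) : le x y -> rank y <= rank x.
Proof. by case=> [->|/lt_rank/ltnW]. Qed.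

Lemma top_max (M : model) (x : M) : le top x -> x = top.
Proof.
case=> // /lt_rank; case: (lt_top x) => // /lt_rank; lia.
Qed.

Fixpoint force (M : model) (A : form) (x : M) : Prop :=
  match A with
  | Var p => val p x
  | Bot => False
  | And B C => force B x /\ force C x
  | Or B C => force B x \/ force C x
  | Neg B => ~ force B x
  | Imp B C => force B x -> force C x
  | Box B => forall y, le x y -> force B y
  end.

Lemma force_Dia (M : model) (A : form) (x : M) :
  force (Dia A) x <-> exists2 y, le x y & force A y.
Proof.
split=> [/= nbA|[y xy Ay] bA]; last exact: bA xy Ay.
by apply: contrapT => nA; apply: nbA => y xy Ay; apply: nA; exists y.
Qed.

Lemma force_Conj (M : model) (s : seq form) (x : M) :
  force (Conj s) x <-> {in s, forall A, force A x}.
Proof.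
elim: s => [|A s IHs] /=; first by split=> // _ [].
rewrite IHs; split=> [[Ax sx] B|sx].
  by rewrite in_cons => /orP[/eqP->|/sx].
split=> [|B sB]; first by apply: sx; rewrite mem_head.
by apply: sx; rewrite in_cons sB orbT.
Qed.

Lemma force_Disj (M : model) (s : seq form) (x : M) :
  force (Disj s) x <-> exists2 A, A \in s & force A x.
Proof.
elim: s => [|A s IHs] /=; first by split=> // -[].
rewrite IHs; split=> [[Ax|[B sB Bx]]|[B]].
- by exists A; rewrite ?mem_head.
- by exists B; rewrite // in_cons sB orbT.
by rewrite in_cons => /orP[/eqP->|sB Bx]; [left|right; exists B].
Qed.

Definition valid (A : form) : Prop := forall (M : model) (x : M), force A x.

Lemma valid_taut (A : form) : tautology A -> valid A.
Proof.
move=> tA M x.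
suff H B : force B x <-> prop_eval (fun C => `[< force C x >]) B.
  by apply/H/tA.
elim: B => [p||B IHB C IHC|B IHB C IHC|B IHB|B IHB C IHC|B _] /=.
- by split=> /asboolP.
- by [].
- by rewrite IHB IHC; split=> /andP.
- by rewrite IHB IHC; split=> /orP.
- by rewrite IHB; split=> /negP.
- by rewrite IHB IHC; split=> /implyP.
by split=> /asboolP.
Qed.

Definition revalue (M : model) (v : nat -> M -> Prop) : model :=
  Model v (@lt_trans M) (@lt_rank M) (@lt_top M).

Lemma force_subst (M : model) (s : nat -> form) (A : form) (x : M) :
  force (subst s A) x <->
  @force (revalue (fun p => force (s p))) A x.
Proof.
elim: A x => [p||B IHB C IHC|B IHB C IHC|B IHB|B IHB C IHC|B IHB] x //=;
  rewrite ?IHB ?IHC //.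
by split=> H y /H /IHB.
Qed.

(** Induction on [rank]: once every world strictly above [y] forces [A], [Imp A (Box A)] holds in
    the whole cone of [y], so the premise yields [A] at [y]. *)
Lemma force_axGrz (M : model) (A : form) (x : M) : force (axGrz A) x.
Proof.
move=> /= H; suff: forall y, le x y -> force A y by apply.
move=> y; have [n] := ubnP (rank y); elim: n y => // n IHn y yn xy.
have above z : lt y z -> force A z.
  move=> yz; apply: IHn; last by apply: le_trans xy _; right.
  by apply: leq_trans (lt_rank yz) _.
apply: H => // z yz Az t [<-|zt] //.
by apply: above; case: yz => [->|/lt_trans]; [|apply].
Qed.

(** Both sides say that [A] holds at [top], the only world above itself. *)
Lemma force_ax2 (M : model) (A : form) (x : M) : force (ax2 A) x.
Proof.
move=> y _; suff: force (Box (Dia A)) y <-> force (Dia (Box A)) y by [].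
rewrite force_Dia; split=> [bdA|[z yz bA] t _].
  exists top => // z /top_max->.
  by have /force_Dia[t /top_max->] : force (Dia A) (top : M) by apply: bdA.
by apply/force_Dia; exists top => //; apply: bA.
Qed.

Lemma valid_normal : normal valid.
Proof.
split=> [|M x /=|A B AB vA M x|A vA M x y _|s A vA M x].
- exact: valid_taut.
- by move=> H0 H1 y xy; apply: H0 xy (H1 _ xy).
- exact/AB/vA.
- exact: vA.
exact/force_subst/vA.
Qed.

Theorem Grz2_sound (A : form) : Grz2 A -> valid A.
Proof.
move/(_ valid valid_normal); apply=> [B /(_ valid valid_normal)|M x].
  apply=> [C /(_ valid valid_normal) //|M x]; exact: force_axGrz.
exact: force_ax2.
Qed.

(* If [x] forces [A], it cannot force [Box (Imp A (Box A))], so passing from [x]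
   to [y] makes a new box true. *)
Lemma refuting_last (M : model) (A : form) (x : M) : ~ force (Box A) x ->
  exists y, [/\ le x y, ~ force A y & force (Box (Imp A (Box A))) y].
Proof.
move=> nbA; apply: contrapT => H; apply: nbA => y xy.
apply: (@force_axGrz M A y) => z yz bA; apply: contrapT => nA.
by apply: H; exists z; split=> //; apply: le_trans yz.
Qed.

(** * Maximal consistent theories *)

Lemma Grz2_normal : normal Grz2.
Proof.
split=> [A tA|| A B AB HA|A HA|s A HA] L nL sL X.
- exact: normal_taut.
- exact: normal_K.
- by apply: (normal_mp nL (A := A)); [apply: AB|apply: HA].
- by apply: (normal_nec nL); apply: HA.
by apply: (normal_subst nL); apply: HA.
Qed.

Lemma Grz2_Grz (A : form) : Grz2 (axGrz A).
Proof.
apply: (normal_subst Grz2_normal (fun=> A) (A := axGrz (Var 0))) => L nL sL _.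
by apply: sL => L' nL' _ X; apply: X.
Qed.

Lemma Grz2_ax2 (A : form) : Grz2 (ax2 A).
Proof.
by apply: (normal_subst Grz2_normal (fun=> A) (A := ax2 (Var 0))) => L nL sL.
Qed.

Lemma Grz2_K (A B : form) : Grz2 (Imp (Box (Imp A B)) (Imp (Box A) (Box B))).
Proof.
exact: (normal_subst Grz2_normal (fun p => if p == 0 then A else B)
  (normal_K Grz2_normal)).
Qed.

(** A theory describes a single world; closure under necessitation would break [theory_ext]. *)
Record theory (S : form -> Prop) : Prop := Theory {
  theory_Grz2 : forall A, Grz2 A -> S A;
  theory_mp : forall A B, S (Imp A B) -> S A -> S B
}.

Ltac taut :=
  let e := fresh "e" in
  move=> e /=;
  repeat match goal with
  | |- context [prop_eval e ?A] => case: (prop_eval e A)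
  | |- context [e ?A] => case: (e A)
  end; done.

Lemma theory_taut (S : form -> Prop) (A : form) :
  theory S -> tautology A -> S A.
Proof.
move=> tS tA; apply: (theory_Grz2 tS); exact: (normal_taut Grz2_normal).
Qed.

Lemma theory_taut1 (S : form -> Prop) (A B : form) :
  theory S -> tautology (Imp A B) -> S A -> S B.
Proof. move=> tS tA; apply: (theory_mp tS); exact: theory_taut. Qed.

Lemma theory_taut2 (S : form -> Prop) (A B C : form) :
  theory S -> tautology (Imp A (Imp B C)) -> S A -> S B -> S C.
Proof.
move=> tS tA SA; apply: (theory_mp tS); exact: (theory_taut1 tS tA).
Qed.

Lemma theory_ext (S : form -> Prop) (A : form) :
  theory S -> theory (fun B => S (Imp A B)).
Proof.
move=> tS; split=> [B HB|B C].
  by apply: (theory_taut1 tS) (theory_Grz2 tS HB); taut.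
by apply: (theory_taut2 tS); taut.
Qed.

Definition mcs (S : form -> Prop) : Prop :=
  [/\ theory S, ~ S Bot & forall A, S A \/ S (Neg A)].

Lemma Lindenbaum (S : form -> Prop) :
  theory S -> ~ S Bot -> exists2 D, mcs D & forall A, S A -> D A.
Proof.
move=> tS nS.
(* Stage [n] adds the formula with code [n] unless it is already refuted. The union of the stages is
   maximal, as [A] is decided at stage [choice.pickle A]. *)
pose step (S' : form -> Prop) n :=
  if (choice.unpickle n : option form) is Some A then
    if `[< S' (Imp A Bot) >] then S' else fun B => S' (Imp A B)
  else S'.
pose chain := fix chain n := if n is n'.+1 then step (chain n') n' else S.
have chainP n : theory (chain n) /\ ~ chain n Bot.
  elim: n => //= n [tn nn]; rewrite /step; case: choice.unpickle => [A|] //.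
  by case: asboolP => // nA; split=> //; apply: theory_ext.
have chainS n A : chain n A -> chain n.+1 A.
  move=> /= nA; rewrite /step; case: choice.unpickle => [B|] //.
  case: asboolP => // _.
  by apply: (theory_taut1 (proj1 (chainP n))) nA; taut.
have chain_le n m A : n <= m -> chain n A -> chain m A.
  move=> /subnK <-; elim: (m - n) => //= k IHk nA.
  by apply: chainS; apply: IHk.
exists (fun A => exists n, chain n A); last by move=> A SA; exists 0.
split; last move=> A.
- split=> [A HA|A B [n nAB] [m mA]].
    by exists 0; apply: (theory_Grz2 tS).
  exists (maxn n m); apply: (theory_mp (proj1 (chainP _)) (A := A)).
    by apply: chain_le nAB; apply: leq_maxl.
  by apply: chain_le mA; apply: leq_maxr.
- by case=> n; case: (chainP n).
have [tn _] := chainP (choice.pickle A).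
have : step (chain (choice.pickle A)) (choice.pickle A) A \/
       chain (choice.pickle A) (Neg A).
  rewrite /step choice.pickleK; case: asboolP => [nA|_].
    by right; apply: (theory_taut1 tn) nA; taut.
  by left; apply: (theory_taut tn); taut.
case=> [sA|nA]; first by left; exists (choice.pickle A).+1.
by right; exists (choice.pickle A).
Qed.

Section MCS.
Variables (D : form -> Prop) (mD : mcs D).

Let tD : theory D. Proof. by case: mD. Qed.

Lemma mcs_Grz2 (A : form) : Grz2 A -> D A.
Proof. exact: theory_Grz2. Qed.

Lemma mcs_Bot : ~ D Bot.
Proof. by case: mD. Qed.

Lemma mcs_Neg (A : form) : D (Neg A) <-> ~ D A.
Proof.
split=> [DnA DA|]; last by case: mD => _ _ /(_ A)[].
by apply: mcs_Bot; apply: (theory_taut2 tD) DnA DA; taut.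
Qed.

Lemma mcs_Imp (A B : form) : D (Imp A B) <-> (D A -> D B).
Proof.
split=> [|AB]; first exact: theory_mp.
have [DA|/mcs_Neg nA] := EM (D A).
  by apply: (theory_taut1 tD) (AB DA); taut.
by apply: (theory_taut1 tD) nA; taut.
Qed.

Lemma mcs_And (A B : form) : D (And A B) <-> D A /\ D B.
Proof.
split=> [AB|[DA DB]]; last by apply: (theory_taut2 tD) DA DB; taut.
by split; apply: (theory_taut1 tD) AB; taut.
Qed.

Lemma mcs_Or (A B : form) : D (Or A B) <-> D A \/ D B.
Proof.
split=> [AB|[]]; [|by apply: (theory_taut1 tD); taut..].
have [DA|/mcs_Neg nA] := EM (D A); first by left.
by right; apply: (theory_taut2 tD) AB nA; taut.
Qed.
End MCS.

Definition acc (D E : form -> Prop) : Prop := forall A, D (Box A) -> E A.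

(** If [Box A] is not in [D], the formulas boxed in [D] are consistent with [Neg A], and
    [Lindenbaum] extends them to a successor refuting [A]. *)
Lemma mcs_Box (D : form -> Prop) (A : form) : mcs D ->
  D (Box A) <-> forall E, mcs E -> acc D E -> E A.
Proof.
move=> mD; split=> [DA E _|H]; first exact.
apply: contrapT => nA.
have tS : theory (fun B => D (Box B)).
  split=> [B HB|B C]; first exact: mcs_Grz2 (normal_nec Grz2_normal HB).
  by have /(mcs_Imp mD) K := mcs_Grz2 mD (Grz2_K B C); move=> /K/(mcs_Imp mD).
have [|E mE sE] := Lindenbaum (theory_ext (Neg A) tS).
  by move=> DA; apply: nA; apply: (theory_taut1 tS) DA; taut.
have /(mcs_Neg mE) : E (Neg A) by apply: sE; apply: (theory_taut tS); taut.
apply; apply: H => // B DB; apply: sE.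
by apply: (theory_taut1 tS) DB; taut.
Qed.

Lemma mcs_Dia (D : form -> Prop) (A : form) : mcs D ->
  D (Dia A) <-> exists E, [/\ mcs E, acc D E & E A].
Proof.
move=> mD; rewrite (mcs_Neg mD) (mcs_Box _ mD); split=> [H|[E [mE DE EA]] H].
  apply: contrapT => nE; apply: H => E mE DE; apply/(mcs_Neg mE) => EA.
  by apply: nE; exists E.
by have /(mcs_Neg mE) := H E mE DE.
Qed.

(** The Grz axiom read over [acc]; reflexivity, transitivity and the refuting successors all come
    from it. *)
Lemma mcs_mem_Grz (D : form -> Prop) (A : form) : mcs D ->
  (forall E, mcs E -> acc D E -> E (Box (Imp A (Box A))) -> E A) -> D A.
Proof.
move=> mD H; have /(mcs_Imp mD) := mcs_Grz2 mD (Grz2_Grz A); apply.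
by apply/(mcs_Box _ mD) => E mE DE; apply/(mcs_Imp mE); apply: H.
Qed.

Lemma acc_refl (D : form -> Prop) : mcs D -> acc D D.
Proof. by move=> mD A DA; apply: mcs_mem_Grz => // E _ DE _; apply: DE. Qed.

(* Boolos's derivation of transitivity from Grz: apply the axiom to
   [p /\ (Box p -> Box (Box p))]. *)
Lemma mcs_BoxBox (D : form -> Prop) (p : form) : mcs D ->
  D (Box p) -> D (Box (Box p)).
Proof.
move=> mD Dp; pose A := And p (Imp (Box p) (Box (Box p))).
have : D A.
  apply: mcs_mem_Grz => // E mE DE EA; apply/(mcs_And mE).
  split; first exact: DE.
  apply/(mcs_Imp mE) => Ep; apply/(mcs_Box _ mE) => F mF EF.
  apply: contrapT => nFp; apply: (nFp).
  have FA : F A.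
    apply/(mcs_And mF); split; first exact: EF.
    by apply/(mcs_Imp mF) => /nFp.
  have /(mcs_Imp mF)/(_ FA) FbA := EF _ EA.
  by apply/(mcs_Box _ mF) => G mG /(_ _ FbA)/(mcs_And mG)[].
by case/(mcs_And mD) => _ /(mcs_Imp mD); apply.
Qed.

Lemma acc_trans (D E F : form -> Prop) : mcs D -> acc D E -> acc E F -> acc D F.
Proof. by move=> mD DE EF A /(mcs_BoxBox mD)/DE/EF. Qed.

(** Canonical counterpart of [refuting_last], giving the strict drop of the deficit in the truth
    lemma. *)
Lemma mcs_refuting_last (D : form -> Prop) (A : form) : mcs D ->
  ~ D (Box A) ->
  exists E, [/\ mcs E, acc D E, ~ E A & E (Box (Imp A (Box A)))].
Proof.
move=> mD nDA; apply: contrapT => H; apply: nDA.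
apply/(mcs_Box _ mD) => E mE DE.
apply: mcs_mem_Grz => // F mF EF FA; apply: contrapT => nFA; apply: H.
by exists F; split=> //; apply: acc_trans EF.
Qed.

Lemma mcs_ax2 (D : form -> Prop) (A : form) : mcs D ->
  D (Box (Dia A)) <-> D (Dia (Box A)).
Proof.
move=> mD; have := acc_refl mD (mcs_Grz2 mD (Grz2_ax2 A)).
by case/(mcs_And mD) => /(mcs_Imp mD) ? /(mcs_Imp mD) ?.
Qed.

(** [T] collects the formulas that are eventually necessary above [D]. Swapping [Dia (Box A)] and
    [Box (Dia A)] by [ax2] gives both modus ponens and maximality. *)
Lemma mcs_final (D : form -> Prop) : mcs D ->
  exists T, [/\ mcs T, forall E, mcs E -> acc D E -> acc E T
              & forall A, T A -> T (Box A)].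
Proof.
move=> mD; exists (fun A => D (Dia (Box A))); split=> [|E mE DE A EA|A].
- split.
  + split=> [A HA|A B].
      apply/(mcs_Dia _ mD); exists D; split=> //; first exact: acc_refl.
      exact: mcs_Grz2 (normal_nec Grz2_normal HA).
    case/(mcs_Dia _ mD) => E [mE DE EAB] /(mcs_Dia _ mD)[F [mF DF FA]].
    (* [F] need not be comparable with [E]; [ax2] moves [Box A] to a successor [G] of [E], where
       both boxes hold. *)
    have : D (Dia (Box (Box A))).
      by apply/(mcs_Dia _ mD); exists F; split=> //; apply: mcs_BoxBox.
    move/(mcs_ax2 _ mD)/DE/(mcs_Dia _ mE)=> [G [mG EG GA]].
    apply/(mcs_Dia _ mD); exists G; split=> //; first exact: acc_trans EG.
    have {}EAB := EG _ (mcs_BoxBox mE EAB).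
    apply/(mcs_Box _ mG) => H mH GH; have /(mcs_Imp mH) := GH _ EAB; apply.
    exact: GH.
  + case/(mcs_Dia _ mD) => E [mE _ /(acc_refl mE)]; exact: mcs_Bot.
  move=> A; have [|nA] := EM (D (Dia (Box A))); first by left.
  right; have /(mcs_Neg mD) : ~ D (Box (Dia A)) by move/(mcs_ax2 _ mD).
  move=> nbdA; apply/(mcs_Dia _ mD); apply: contrapT => H.
  move/(mcs_Neg mD): nbdA; apply; apply/(mcs_Box _ mD) => E mE DE.
  by apply/(mcs_Neg mE) => EA; apply: H; exists E.
- by apply/(mcs_Dia _ mD); exists E.
case/(mcs_Dia _ mD) => E [mE DE EA]; apply/(mcs_Dia _ mD); exists E; split=> //.
exact: mcs_BoxBox.
Qed.

(** * Completeness *)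

Fixpoint boxed (A : form) : seq form :=
  match A with
  | Var _ | Bot => [::]
  | And B C | Or B C | Imp B C => boxed B ++ boxed C
  | Neg B => boxed B
  | Box B => B :: boxed B
  end.

Definition grz_boxes (A : form) : seq form :=
  [seq Box B | B <- boxed A] ++ [seq Box (Imp B (Box B)) | B <- boxed A].

Lemma grz_boxes_Box (A B : form) : B \in boxed A -> Box B \in grz_boxes A.
Proof. by move=> AB; rewrite mem_cat map_f. Qed.

Lemma grz_boxes_Imp (A B : form) :
  B \in boxed A -> Box (Imp B (Box B)) \in grz_boxes A.
Proof. by move=> AB; rewrite mem_cat orbC (map_f (fun B => _)). Qed.

(** * Counting failing boxes *)

Section Deficit.
Variables (W : Type) (holds : form -> W -> Prop) (t : W) (s : seq form).

(** The last summand separates [t] from other worlds with the same true boxes. [holds] is abstract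
    so as to cover both membership in a theory and forcing. *)
Definition deficit (x : W) : nat :=
  count (fun A => ~~ `[< holds A x >]) s + ~~ `[< x = t >].

Definition incl (x y : W) : Prop := {in s, forall A, holds A x -> holds A y}.

Variables (x y : W).
Hypotheses (xy : incl x y) (xyt : x = t -> y = t).

Let top_bit : ~~ `[< y = t >] <= ~~ `[< x = t >].
Proof. by case: asboolP => //; case: asboolP => // /xyt. Qed.

Let fails_sub :
  {in s, forall A, ~~ `[< holds A y >] -> ~~ `[< holds A x >]}.
Proof. by move=> A sA; apply: contra => /asboolP /(xy sA)/asboolP. Qed.

Lemma deficit_le : deficit y <= deficit x.
Proof. by apply: leq_add => //; apply: leq_count_in. Qed.

Lemma deficit_lt (A : form) :
  A \in s -> holds A y -> ~ holds A x -> deficit y < deficit x.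
Proof.
move=> sA Ay nAx; rewrite /deficit -addSn; apply: leq_add => //.
apply: (ltn_count_in fails_sub sA); first exact/asboolPn.
by rewrite negbK; apply/asboolP.
Qed.

Lemma deficit_lt_top : x <> t -> y = t -> deficit y < deficit x.
Proof.
move=> xt yt; rewrite /deficit -addnS; apply: leq_add.
  exact: leq_count_in.
by case: (asboolP (x = t)) => // _; case: asboolP.
Qed.
End Deficit.

Section Canonical.
Variables (A0 : form) (D T : form -> Prop).
Hypotheses (mT : mcs T) (T_final : forall E, mcs E -> acc D E -> acc E T)
  (T_Box : forall A, T A -> T (Box A)) (DT : acc D T) (mD : mcs D).

(** Restricted to successors of [D], because [T] is final only for these. *)
Definition canonical_world : Type := {E : form -> Prop | mcs E /\ acc D E}.

Let mem (A : form) (x : canonical_world) : Prop := sval x A.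
Let ctop : canonical_world := exist _ T (conj mT DT).
Let crank := deficit mem ctop (grz_boxes A0).
(** Used in place of [acc], which need not have finite rank: here each step makes the deficit
    drop. *)
Let clt (x y : canonical_world) : Prop :=
  incl mem (grz_boxes A0) x y /\ crank y < crank x.

Let clt_trans x y z : clt x y -> clt y z -> clt x z.
Proof.
move=> [xy yx] [yz zy]; split; last exact: ltn_trans yx.
by move=> A sA /xy-/(_ sA) /yz-/(_ sA).
Qed.

Let clt_top x : x = ctop \/ clt x ctop.
Proof.
have [|xt] := EM (x = ctop); first by left.
have incl_t : incl mem (grz_boxes A0) x ctop.
  move=> A; rewrite mem_cat => /orP[]/mapP[B _ ->] xB; apply: T_Box;
  by case: x {xt} xB => E [mE DE]; apply: T_final.
by right; split=> //; apply: deficit_lt_top.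
Qed.

Definition canonical : model :=
  @Model canonical_world clt crank ctop (fun p => mem (Var p))
    clt_trans (fun _ _ => @proj2 _ _) clt_top.

(** In the box case, a world containing [B] but not [Box B] has a successor refuting [B] where
    [Box (Imp B (Box B))] becomes true, so it lies strictly above in [clt]. *)
Lemma truth_canonical (A : form) (x : canonical) :
  {subset boxed A <= boxed A0} -> force A x <-> mem A x.
Proof.
elim: A x => [p||B IHB C IHC|B IHB C IHC|B IHB|B IHB C IHC|B IHB] x sA //=.
- by split=> // /mcs_Bot; apply; case: (svalP x).
- rewrite IHB ?IHC => [|E EC|E EB];
    try by apply: sA; rewrite mem_cat ?EC ?EB ?orbT.
  by rewrite /mem mcs_And //; case: (svalP x).
- rewrite IHB ?IHC => [|E EC|E EB];
    try by apply: sA; rewrite mem_cat ?EC ?EB ?orbT.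
  by rewrite /mem mcs_Or //; case: (svalP x).
- by rewrite IHB // /mem mcs_Neg //; case: (svalP x).
- rewrite IHB ?IHC => [|E EC|E EB];
    try by apply: sA; rewrite mem_cat ?EC ?EB ?orbT.
  by rewrite /mem mcs_Imp //; case: (svalP x).
have A0B : B \in boxed A0 by apply: sA; rewrite mem_head.
have {}IHB (y : canonical) : force B y <-> mem B y.
  by apply: IHB => C BC; apply: sA; rewrite in_cons BC orbT.
have sBox := grz_boxes_Box A0B; have sImp := grz_boxes_Imp A0B.
have [mx Dx] := svalP x; split=> [xB|xB y xy]; last first.
  apply/IHB; have [my _] := svalP y; apply: (acc_refl my).
  by case: xy => [<-|[xy _]] //; apply: xy.
apply: contrapT => nxB.
have xB0 : mem B x by apply/IHB/xB.
have [E [mE xE nEB EB]] := mcs_refuting_last mx nxB.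
pose y : canonical := exist _ E (conj mE (acc_trans mD Dx xE)).
have xy : incl mem (grz_boxes A0) x y.
  move=> A; rewrite mem_cat => /orP[]/mapP[C _ ->] /(mcs_BoxBox mx); exact: xE.
suff le_xy : le x y by apply: nEB; apply/(IHB y)/xB.
right; split=> //; apply: (deficit_lt xy _ sImp) => //.
  (* [x] is not the top, since [T_Box] would put [Box B] in it. *)
  by move=> xt; case: nxB; move: xB0; rewrite xt; apply: T_Box.
move=> xI; apply: nxB; have /(mcs_Imp mx) := acc_refl mx xI; exact.
Qed.
End Canonical.

Theorem Grz2_complete (A : form) : valid A -> Grz2 A.
Proof.
move=> vA; apply: contrapT => nA.
have tG : theory Grz2 by split=> //; apply: (normal_mp Grz2_normal).
have [|D mD sD] := Lindenbaum (theory_ext (Neg A) tG).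
  by move=> HA; apply: nA; apply: (theory_taut1 tG) HA; taut.
have [T [mT fT bT]] := mcs_final mD.
have DT := fT D mD (acc_refl mD).
have /(mcs_Neg mD) : D (Neg A) by apply: sD; apply: (theory_taut tG); taut.
pose M := canonical A mT fT bT DT.
pose x : M := exist _ D (conj mD (acc_refl mD)).
have [Ax _] := @truth_canonical A D T mT fT bT DT mD A x (fun _ => id).
by apply; apply: Ax; apply: vA.
Qed.

(** * Directed layered bisimulations *)

Section Simulation.
Variable Q : polarity -> {fset nat}.

Definition atom_sim (K M : model) (k : K) (m : M) : Prop :=
  (forall p, p \in Q Plus -> val p k -> val p m) /\
  (forall p, p \in Q Minus -> val p m -> val p k).

(** The index counts the moves left; only the atoms are directed, the moves go both ways. *)
Fixpoint sim (K M : model) (n : nat) (k : K) (m : M) : Prop :=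
  if n is n'.+1 then
    [/\ atom_sim k m,
        forall k', le k k' -> exists2 m', le m m' & sim n' k' m'
      & forall m', le m m' -> exists2 k', le k k' & sim n' k' m']
  else atom_sim k m.

Lemma sim_atom (K M : model) (n : nat) (k : K) (m : M) :
  sim n k m -> atom_sim k m.
Proof. by case: n => [|n] // []. Qed.

Lemma sim_leq (K M : model) (n n' : nat) (k : K) (m : M) :
  n' <= n -> sim n k m -> sim n' k m.
Proof.
elim: n n' k m => [|n IHn] [|n'] k m //; first by move=> _ /sim_atom.
rewrite ltnS => n'n [a zig zag]; split=> // [k' /zig[m']|m' /zag[k']] ? s.
  by exists m' => //; apply: IHn s.
by exists k' => //; apply: IHn s.
Qed.

(** A move to [top] in [M], then one to [top] in [K], relates the two tops on atoms. As tops see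
    only themselves, this suffices for every layer. *)
Lemma sim_top (K M : model) (n : nat) (k : K) (m : M) :
  sim 2 k m -> sim n (top : K) (top : M).
Proof.
case=> _ _ /(_ top (le_top _))[k1 _ [_ /(_ top (le_top _))[m1 /top_max-> a] _]].
elim: n => // n IHn; split=> // [k2|m2] /top_max->; by exists top.
Qed.

Definition literals : seq form :=
  [seq Var p | p <- Q Plus] ++ [seq Neg (Var p) | p <- Q Minus].

Fixpoint layer (n : nat) : seq form :=
  if n is n'.+1 then
    layer n' ++ [seq Box (Disj s) | s <- subseqs (layer n')]
             ++ [seq Dia (Conj s) | s <- subseqs (layer n')]
  else literals.

Lemma vars_layer (n : nat) (A : form) (o : polarity) :
  A \in layer n -> (vars o A `<=` Q o)%fset.
Proof.
elim: n A o => [|n IHn] A o /=; rewrite !mem_cat.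
  case/orP=> /mapP[p Qp ->]; case: o => /=; by rewrite ?fsub0set ?fsub1set.
case/or3P=> [/IHn //|/mapP[s /mem_subseqs sl ->]|/mapP[s /mem_subseqs sl ->]].
  by apply: vars_foldr => // B /sl /IHn.
have -> : vars o (Dia (Conj s)) = vars o (Conj s) by case: o.
by apply: vars_foldr => // B /sl /IHn.
Qed.

(** A move to [k'] is answered through [Dia] of the conjunction of what [k'] forces; an unanswered
    move to [m'] would contradict [Box] of the disjunction of what fails at [m']. *)
Lemma sim_layer (K M : model) (n : nat) (k : K) (m : M) :
  {in layer n, forall A, force A k -> force A m} -> sim n k m.
Proof.
have sim_lits (x : K) (y : M) :
    {in literals, forall A, force A x -> force A y} -> atom_sim x y.
  move=> H; split=> p Qp.
    by apply: (H (Var p)); rewrite mem_cat map_f.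
  move=> py; apply: contrapT => npx.
  apply: (H (Neg (Var p)) _ npx py).
  by rewrite mem_cat orbC (map_f (fun q => _)).
elim: n k m => [|n IHn] k m H; first exact: sim_lits.
split=> [|k' kk'|m' mm'].
- suff /IHn/sim_atom : {in layer n, forall A, force A k -> force A m} by [].
  by move=> A nA; apply: H; rewrite mem_cat nA.
- pose s := [seq A <- layer n | `[< force A k' >]].
  have /force_Dia[m' mm' /force_Conj sm'] : force (Dia (Conj s)) m.
    apply: H.
      by rewrite !mem_cat (map_f (fun s => _)) ?orbT ?filter_subseqs.
    apply/force_Dia; exists k' => //; apply/force_Conj => A.
    by rewrite mem_filter => /andP[/asboolP].
  exists m' => //; apply: IHn => A nA k'A; apply: sm'.
  by rewrite mem_filter nA andbT; apply/asboolP.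
apply: contrapT => nk'.
pose s := [seq A <- layer n | `[< ~ force A m' >]].
have mBox : force (Box (Disj s)) m.
  apply: H.
    by rewrite !mem_cat (map_f (fun s => _)) ?orbT ?filter_subseqs.
  move=> k' kk'; apply/force_Disj; apply: contrapT => ns; apply: nk'.
  exists k' => //; apply: IHn => A nA k'A; apply: contrapT => nm'; apply: ns.
  by exists A; rewrite // mem_filter nA andbT; apply/asboolP.
have /force_Disj[A] := mBox _ mm'.
by rewrite mem_filter => /andP[/asboolP].
Qed.
End Simulation.

(** * Transfer of signed formulas along a relation *)

Section Transfer.
Variables (X Y : model) (Z : X -> Y -> Prop) (boxable : form -> Prop)
  (U : polarity -> nat -> Prop).
Hypothesis Z_val : forall x y, Z x y -> forall p,
  (U Plus p -> val p x -> val p y) /\ (U Minus p -> val p y -> val p x).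
Hypothesis Z_Box : forall B, boxable B ->
  (forall x y, Z x y -> force B x -> force B y) ->
  forall x y, Z x y -> force (Box B) x -> force (Box B) y.
Hypothesis Z_Box' : forall B, boxable B ->
  (forall x y, Z x y -> force B y -> force B x) ->
  forall x y, Z x y -> force (Box B) y -> force (Box B) x.

(** Both directions are proved together because [Neg] and the left side of [Imp] exchange them. *)
Let transfer (A : form) : {in boxed A, forall B, boxable B} ->
  ((forall o p, p \in vars o A -> U o p) ->
     forall x y, Z x y -> force A x -> force A y) /\
  ((forall o p, p \in vars (flip o) A -> U o p) ->
     forall x y, Z x y -> force A y -> force A x).
Proof.
have split2 (s1 s2 : seq form) : {in s1 ++ s2, forall B, boxable B} ->
    {in s1, forall B, boxable B} /\ {in s2, forall B, boxable B}.
  by move=> H; split=> B sB; apply: H; rewrite mem_cat sB ?orbT.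
have splitU (V1 V2 : polarity -> {fset nat}) :
    (forall o p, p \in V1 o `|` V2 o -> U o p)%fset ->
    (forall o p, p \in V1 o -> U o p) /\ (forall o p, p \in V2 o -> U o p).
  by move=> H; split=> o p Vp; apply: H; rewrite in_fsetU Vp ?orbT.
have unflip (B : form) : (forall o p, p \in vars (flip (flip o)) B -> U o p) ->
    forall o p, p \in vars o B -> U o p.
  by move=> H [] p; [apply: (H Plus)|apply: (H Minus)].
elim: A => [p||B IHB C IHC|B IHB C IHC|B IHB|B IHB C IHC|B IHB] sA.
- split=> [/(_ Plus p)|/(_ Minus p)] /=;
    rewrite in_fset1 eqxx => /(_ isT) Up x y;
    by case/Z_val/(_ p) => ? ?; auto.
- by split.
- have [/IHB[B1 B2] /IHC[C1 C2]] := split2 _ _ sA.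
  split=> /splitU[UB UC] x y xy /= [hB hC].
    by split; [apply: (B1 UB x)|apply: (C1 UC x)].
  by split; [apply: (B2 UB x y)|apply: (C2 UC x y)].
- have [/IHB[B1 B2] /IHC[C1 C2]] := split2 _ _ sA.
  split=> /splitU[UB UC] x y xy /= [hB|hC].
  + by left; apply: (B1 UB x).
  + by right; apply: (C1 UC x).
  + by left; apply: (B2 UB x y).
  by right; apply: (C2 UC x y).
- have [B1 B2] := IHB sA; split=> UB x y xy /= nB hB; apply: nB.
    exact: (B2 UB x y).
  exact: (B1 (unflip _ UB) x y).
- have [/IHB[B1 B2] /IHC[C1 C2]] := split2 _ _ sA.
  split=> /splitU[UB UC] x y xy /= BC hB.
    by apply: (C1 UC x) => //; apply: BC; apply: (B2 UB x y).
  by apply: (C2 UC x y) => //; apply: BC; apply: (B1 (unflip _ UB) x y).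
have bB : boxable B by apply: sA; rewrite mem_head.
have [|B1 B2] := IHB; first by move=> C BC; apply: sA; rewrite in_cons BC orbT.
by split=> /= UB; [apply: Z_Box bB (B1 UB)|apply: Z_Box' bB (B2 UB)].
Qed.

Lemma signed_transfer (A : form) (x : X) (y : Y) :
  {in boxed A, forall B, boxable B} ->
  (forall o p, p \in vars o A -> U o p) ->
  Z x y -> force A x -> force A y.
Proof. by move=> /transfer[H _] /H; apply. Qed.
End Transfer.

(** * Amalgamation *)

Section Amalgam.
Variables (phi : form) (P : polarity -> {fset nat}) (K M : model).

Let Q (o : polarity) : {fset nat} := (vars o phi `\` P o)%fset.

Local Notation sim := (@sim Q K M).

Let holds (A : form) (k : K) : Prop := force A k.
Let rho : K -> nat := deficit holds top (grz_boxes phi).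
Let sub : K -> K -> Prop := incl holds (grz_boxes phi).

Let le_sub k k' : le k k' -> sub k k'.
Proof.
move=> kk' A; rewrite mem_cat => /orP[]/mapP[B _ ->] kB y /(le_trans kk');
  exact: kB.
Qed.

Let sub_trans k1 k2 k3 : sub k1 k2 -> sub k2 k3 -> sub k1 k3.
Proof. by move=> s12 s23 A sA /s12-/(_ sA) /s23-/(_ sA). Qed.

Let le_topl (k k' : K) : le k k' -> k = top -> k' = top.
Proof. by move=> + kt; rewrite kt => /top_max. Qed.

Let rho_le k k' : le k k' -> rho k' <= rho k.
Proof. by move=> kk'; apply: deficit_le (le_sub kk') (le_topl kk'). Qed.

(** A relevant box gained on the way up would lower [rho]. *)
Let rho_eq_sub k k' : le k k' -> rho k' = rho k -> sub k' k.
Proof.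
move=> kk' e A sA k'A; apply: contrapT => nkA.
by have := deficit_lt (le_sub kk') (le_topl kk') sA k'A nkA; rewrite -/rho; lia.
Qed.

(* A pair may have used up its odd layer; the witness [k', m'] keeps that layer
   available for answering moves in [M] that do not decrease [rho]. *)
Let linked (z : K * M) : Prop :=
  sim (rho z.1).*2 z.1 z.2 /\
  exists k' m', [/\ sub z.1 k', rho k' = rho z.1, le m' z.2
                  & sim (rho z.1).*2.+1 k' m'].

Let linked_self k m : sim (rho k).*2.+1 k m -> linked (k, m).
Proof. by move=> s; split; [apply: sim_leq s|exists k, m; split=> // A]. Qed.

Hypothesis sim_tops : forall n, sim n (top : K) (top : M).

Definition amalgam_world : Type := {z : K * M | linked z}.

(** First components are compared by [sub] and not [le]: an answer in [amalgam_zag] lies above the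
    witness [k'], which need not lie above the original point of [K]. *)
Let alt (x y : amalgam_world) : Prop :=
  [/\ le (sval x).2 (sval y).2, sub (sval x).1 (sval y).1
    & rho (sval y).1 + rank (sval y).2 < rho (sval x).1 + rank (sval x).2].

Let atop : amalgam_world :=
  exist _ (top : K, top : M) (linked_self (sim_tops _)).

(** The least valuation passing positive variables of [phi] up from [K] and variables outside
    [P Minus] up from [M]. Where the two sources mix, the variable lies in [Q] and [atom_sim]
    applies. *)
Let aval (p : nat) (x : amalgam_world) : Prop :=
  (p \in vars Plus phi /\ val p (sval x).1) \/
  (p \notin P Minus /\ val p (sval x).2).

Let alt_trans x y z : alt x y -> alt y z -> alt x z.
Proof.
move=> [m1 s1 r1] [m2 s2 r2]; split.
- exact: le_trans m2.
- exact: sub_trans s2.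
exact: ltn_trans r1.
Qed.

Let alt_top x : x = atop \/ alt x atop.
Proof.
case: x => -[k m] l; have [[kt mt]|nt] := EM (k = top /\ m = top).
  by left; subst; congr (exist _ _ _); apply: Prop_irrelevance.
right; split=> //=; first exact: le_sub.
have rho_top := rho_le (le_top k).
case: (lt_top m) => [mt|/lt_rank]; last by lia.
(* With [m] already on top, the rank drops through the extra unit that [rho] counts at [k]. *)
have kt : k <> top by move=> kt; apply: nt.
have := deficit_lt_top (le_sub (le_top k)) kt erefl.
by rewrite -/rho mt; lia.
Qed.

Let alt_rank x y : alt x y ->
  rho (sval y).1 + rank (sval y).2 < rho (sval x).1 + rank (sval x).2.
Proof. by case. Qed.

Definition amalgam : model :=
  @Model amalgam_world alt (fun x => rho (sval x).1 + rank (sval x).2)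
    atop aval alt_trans alt_rank alt_top.

Lemma amalgam_le (x y : amalgam) :
  le x y -> le (sval x).2 (sval y).2 /\ sub (sval x).1 (sval y).1.
Proof. by case=> [->|[]] //; split=> // A. Qed.

Lemma amalgam_zag (x : amalgam) (m : M) :
  le (sval x).2 m -> exists2 y : amalgam, le x y & (sval y).2 = m.
Proof.
case=> [<-|xm]; first by exists x.
case: x xm => -[k m0] l /= m0m; have [_ [k' [m' [/= kk' e m'm0 s']]]] := l.
have m'm : le m' m by apply: le_trans m'm0 _; right.
have [_ _ /(_ m m'm)[k2 k'k2 s2]] := s'; have r2 := rho_le k'k2.
have l2 : linked (k2, m).
  (* If [rho] is unchanged, the even layer remains and the old witness is reused; if it drops, the
     layers left cover a fresh odd one. *)
  have [e2|ne2] := eqVneq (rho k2) (rho k').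
    split=> /=; first by rewrite e2 e.
    by exists k', m'; rewrite e2 e; split=> //; apply: rho_eq_sub.
  by apply: linked_self; apply: sim_leq s2; lia.
exists (exist _ (k2, m) l2) => //; right; split=> /=; first by right.
  exact: sub_trans (le_sub k'k2).
by have := lt_rank m0m; lia.
Qed.

(** Not every move in [K] is matched; it is enough to refute the relevant boxes, at the point itself
    or after a drop of [rho]. *)
Lemma amalgam_zig (x : amalgam) (A : form) :
  A \in boxed phi -> ~ force (Box A) (sval x).1 ->
  exists2 y : amalgam, le x y & ~ force A (sval y).1.
Proof.
case: x => -[k m] l /= phiA nkA; have [kA|nkA'] := EM (force A k); last first.
  by exists (exist _ (k, m) l).
have [k2 [kk2 nk2A k2I]] := refuting_last nkA.
have r2 : rho k2 < rho k.
  apply: (deficit_lt (le_sub kk2) (le_topl kk2) (grz_boxes_Imp phiA) k2I).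
  by move=> kI; apply: nkA; apply: kI.
have [s _] := l; move: s => /= s.
(* The drop of [rho] frees two layers: one pays for the move, the other is the odd layer of the new
   pair. *)
have : sim (rho k2).*2.+2 k m by apply: sim_leq s; lia.
case=> _ /(_ _ kk2)[m2 mm2 s2] _.
exists (exist _ (k2, m2) (linked_self s2)) => //; right; split=> //=.
  exact: le_sub.
by have := le_rank mm2; lia.
Qed.

(** Upwards, [sub] preserves a relevant box, and reflexivity in [K] unboxes it; the converse is
    [amalgam_zig]. *)
Lemma amalgam_left (x : amalgam) : force phi (sval x).1 -> force phi x.
Proof.
apply: (@signed_transfer K amalgam (fun k x => k = (sval x).1)
  (fun B => B \in boxed phi) (fun o p => p \in vars o phi)) => //.
- move=> k y -> p; split=> [phip yp|phip [[]|[nPp]]] //; first by left.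
  have [/sim_atom [_ sP] _] := svalP y; apply: sP.
  by rewrite in_fsetD nPp.
- move=> B phiB H k y -> kB z /amalgam_le[_ yz].
  have zB : force (Box B) (sval z).1 by apply: yz (grz_boxes_Box phiB) kB.
  by apply: H (erefl _) _; apply: zB.
move=> B phiB H k y -> yB; apply: contrapT => /(amalgam_zig phiB)[z yz].
by apply; apply: H (erefl _) _; apply: yB.
Qed.

Lemma amalgam_right (psi : form) (x : amalgam) :
  (forall o, vars o psi `&` P o = fset0)%fset ->
  force psi x -> force psi (sval x).2.
Proof.
move=> psiP; apply: (@signed_transfer amalgam M (fun y m => (sval y).2 = m)
  (fun=> True) (fun o p => p \notin P o)) => //.
- move=> y m <- p; split=> [nPp [[phip yp]|[]]|nPp yp] //; last by right.
  have [/sim_atom [sP _] _] := svalP y; apply: sP yp.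
  by rewrite in_fsetD nPp.
- move=> B _ H y m <- yB m' /amalgam_zag[z yz zm'].
  by apply: H zm' _; apply: yB.
- move=> B _ H y m <- yB z /amalgam_le[yz _].
  by apply: H (erefl _) _; apply: yB.
move=> o p psip; apply/negP => Pp.
by have := in_fset0 p; rewrite -(psiP o) in_fsetI psip Pp.
Qed.

Lemma amalgam_exists (k : K) (m : M) :
  sim ((size (grz_boxes phi)).+1.*2.+1) k m ->
  exists x : amalgam, sval x = (k, m).
Proof.
move=> s; suff l : linked (k, m) by exists (exist _ (k, m) l).
apply: linked_self; apply: sim_leq s; rewrite ltnS leq_double /rho /deficit.
by rewrite -addn1 leq_add ?count_size ?leq_b1.
Qed.
End Amalgam.

(** * The interpolant *)

Theorem theorem10p11 : uniform_Lyndon_interpolation Grz2.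
Proof.
move=> phi P; pose Q o := (vars o phi `\` P o)%fset.
(* [rho] is at most the number of relevant boxes plus the unit for the top, and a pair needs layer
   [rho.*2.+1]. *)
pose n := (size (grz_boxes phi)).+1.*2.+1.
pose s := [seq A <- [seq Disj r | r <- subseqs (layer Q n)]
             | `[< Grz2 (Imp phi A) >]].
exists (Conj s); split=> [|o|psi phi_psi psiP].
- apply: Grz2_complete => M x phix; apply/force_Conj => A.
  rewrite mem_filter => /andP[/asboolP/Grz2_sound vA _]; exact: vA.
- apply: vars_foldr; try by case: o.
  move=> A; rewrite mem_filter => /andP[_ /mapP[r /mem_subseqs rQ ->]].
  by apply: vars_foldr; try (by case: o); move=> B /rQ; apply: vars_layer.
apply: Grz2_complete => M m /force_Conj sm.
(* Were [Disj r] a consequence of [phi], it would be a conjunct of the interpolant and hold at [m];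
   so some [K], [k] refutes it, and [k] forces only stock formulas true at [m]. *)
pose r := [seq A <- layer Q n | `[< ~ force A m >]].
have nr : ~ Grz2 (Imp phi (Disj r)).
  move=> phir; have /force_Disj[A] : force (Disj r) m.
    apply: sm; rewrite mem_filter map_f ?filter_subseqs // andbT.
    exact/asboolP.
  by rewrite mem_filter => /andP[/asboolP].
have [K [k phik nrk]] : exists (K : model), exists2 k : K,
    force phi k & ~ force (Disj r) k.
  apply: contrapT => H; apply: nr; apply: Grz2_complete => K k phik.
  by apply: contrapT => nrk; apply: H; exists K, k.
have km : sim Q n k m.
  apply: sim_layer => A nA kA; apply: contrapT => nmA; apply: nrk.
  apply/force_Disj; exists A => //; rewrite mem_filter nA andbT.
  exact/asboolP.
have tops N : sim Q N (top : K) (top : M).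
  by apply: sim_top (sim_leq (n' := 2) _ km).
have [x ex] := amalgam_exists tops km.
have := @amalgam_right phi P K M tops psi x psiP; rewrite ex; apply.
apply: (Grz2_sound phi_psi); apply: amalgam_left; by rewrite ex.
Qed.
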